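(* Let $X$ be a strictly convex $d$-dimensional Minkowski space with norm $\|\cdot\|$. If $x_1,\dots,x_m\in X$ are unit vectors satisfying the collapsing condition $$\Bigl\|\sum_{i\in J}x_i\Bigr\|\le 1\quad\text{for every } J\subseteq\{1,\dots,m\},$$ then $m\le d+1$. Furthermore, if in addition the balancing condition is not satisfied, i.e. $\sum_{i=1}^m x_i\ne 0$, then $m\le d$.
   Context: A Minkowski space is a finite-dimensional real Banach space. It is strictly convex if $\|x\|=\|y\|=1$ and $x\ne y$ imply $\|\tfrac12(x+y)\|<1$. *)

(* Defs.v *)
From HB Require Import structures.
From mathcomp Require Import all_boot all_order all_algebra.
From mathcomp Require Import all_classical all_reals all_analysis.
Set Implicit Arguments.
Unset Strict Implicit.
Unset Printing Implicit Defensive.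
Import Order.TTheory GRing.Theory Num.Theory numFieldNormedType.Exports.
Local Open Scope ring_scope.

(* Finite-dimensionality is carried by the vector-space structure, which
   shares its linear structure with the (complete) normed module. *)
#[short(type="minkowskiSpaceType")]
HB.structure Definition MinkowskiSpace (R : realType) :=
  {X of CompleteNormedModule R X & Vector R X}.

Definition strictly_convex (R : realType) (X : minkowskiSpaceType R) : Prop :=
  forall x y : X, `|x| = 1 -> `|y| = 1 -> x <> y -> `|2^-1 *: (x + y)| < 1.

Definition collapsing (R : realType) (X : minkowskiSpaceType R) (m : nat)
    (x : 'I_m -> X) : Prop :=
  forall J : {set 'I_m}, `|\sum_(i in J) x i| <= 1.

Definition balancing (R : realType) (X : minkowskiSpaceType R) (m : nat)
    (x : 'I_m -> X) : Prop :=
  \sum_(i < m) x i = 0.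

(* Main.v *)
(** Suppose [\sum_j c_j x_j = 0], where [c_i >= 0] is the largest coefficient,
and put [t_j = c_i - c_j >= 0], so that [t_i = 0] and
[\sum_j t_j x_j = c_i S] with [S = \sum_j x_j].  If [c] is not constant, let
[t_k] be the largest of the [t_j] and [e = 1 / (2 t_k)].  By convexity the
collapsing condition gives [|\sum_j s_j x_j| <= 1] for all [s_j] in [[0, 1]];
hence [x_i + e c_i S = x_i + \sum_j e t_j x_j], whose coefficient at [x_k] is
[1/2], is the midpoint of two distinct points of the unit ball and has norm
[< 1].  But [|S - x_i| <= 1] yields
[|x_i + e c_i S| >= (1 + e c_i) - e c_i = 1].  So the only linear relations
among the [x_j] have constant coefficients: any [m - 1] of the vectors are
independent, and all [m] of them are when [S] is nonzero. *)
Require Import Defs.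
From mathcomp Require Import all_boot all_order all_algebra.
From mathcomp Require Import all_classical all_reals all_analysis.
From mathcomp Require Import lra.
Import Order.TTheory GRing.Theory Num.Theory numFieldNormedType.Exports.
Local Open Scope ring_scope.

(** Strict convexity is needed only when both norms equal 1; otherwise the triangle inequality is
    already strict. *)
Lemma strictly_convex_midpoint (R : realType) (X : minkowskiSpaceType R)
    (hconv : strictly_convex X) (u v : X) :
  `|u| <= 1 -> `|v| <= 1 -> u <> v -> `|2^-1 *: (u + v)| < 1.
Proof.
move=> u1 v1 uv.
have [eu|nu] := eqVneq `|u| 1; have [ev|nv] := eqVneq `|v| 1.
- exact: hconv.
all: rewrite normrZ ger0_norm ?invr_ge0 //.
all: have := ler_normD u v.
- have : `|v| < 1 by rewrite lt_neqAle nv.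
  lra.
- have : `|u| < 1 by rewrite lt_neqAle nu.
  lra.
- have : `|v| < 1 by rewrite lt_neqAle nv.
  lra.
Qed.

Section Collapsing.
Variables (R : realType) (X : minkowskiSpaceType R) (m : nat) (x : 'I_m -> X).
Hypothesis hcol : collapsing x.

(** The sum is affine in each [s j], hence a convex combination of its values at [s j = 0] and
    [s j = 1]. Induction on [r] rounds one coefficient at a time; [J] collects the indices rounded
    to 1. *)
Lemma collapsing_box_seq (s : 'I_m -> R) (r : seq 'I_m) (J : {set 'I_m}) :
  (forall j, 0 <= s j <= 1) -> uniq r -> {in r, forall j, j \notin J} ->
  `|\sum_(j in J) x j + \sum_(j <- r) s j *: x j| <= 1.
Proof.
move=> hs; elim: r J => [|a r IH] J /=; first by rewrite big_nil addr0.
move=> /andP[ar ur] rJ.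
have aJ : a \notin J by apply: rJ; rewrite mem_head.
have hJ : {in r, forall j, j \notin J}.
  by move=> j jr; apply: rJ; rewrite inE jr orbT.
have haJ : {in r, forall j, j \notin a |: J}.
  move=> j jr; rewrite !inE negb_or hJ // andbT.
  by apply: contraNneq ar => <-.
have := IH _ ur haJ; have := IH _ ur hJ.
rewrite big_setU1 //= big_cons.
set u := \sum_(j in J) x j; set w := \sum_(j <- r) _ => h0 h1.
have -> : u + (s a *: x a + w) = (1 - s a) *: (u + w) + s a *: (x a + u + w).
  rewrite -(addrA (x a)) [s a *: (x a + _)]scalerDr [RHS]addrCA.
  by rewrite -scalerDl subrK scale1r addrCA.
have /andP[sa0 sa1] := hs a.
apply: le_trans (ler_normD _ _) _; rewrite !normrZ !ger0_norm ?subr_ge0 //.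
have := ler_wpM2l sa0 h1.
have : (1 - s a) * `|u + w| <= (1 - s a) * 1 by rewrite ler_wpM2l ?subr_ge0.
lra.
Qed.

Lemma collapsing_box (s : 'I_m -> R) :
  (forall j, 0 <= s j <= 1) -> `|\sum_j s j *: x j| <= 1.
Proof.
move=> hs; have := @collapsing_box_seq s (index_enum _) finset.set0 hs (index_enum_uniq _).
by rewrite big_set0 add0r; apply=> j _; rewrite inE.
Qed.

Hypotheses (hconv : strictly_convex X) (hunit : forall i, `|x i| = 1).

Lemma collapsing_box_lt1 (s : 'I_m -> R) (k : 'I_m) :
  (forall j, 0 <= s j <= 1) -> s k = 2^-1 -> `|\sum_j s j *: x j| < 1.
Proof.
move=> hs sk.
(* The endpoints [p 0] and [p 1] differ by the unit vector [x k], so they are distinct. *)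
pose p b j := if j == k then b else s j.
have pE b : \sum_j p b j *: x j = b *: x k + \sum_(j | j != k) s j *: x j.
  rewrite (bigD1 k) //= /p eqxx; congr (_ + _).
  by apply: eq_bigr => j /negPf ->.
have p01 b : 0 <= b <= 1 -> forall j, 0 <= p b j <= 1.
  by move=> hb j; rewrite /p; case: ifP.
have p0 := collapsing_box _ (p01 0 _); have p1 := collapsing_box _ (p01 1 _).
have -> : \sum_j s j *: x j
    = 2^-1 *: (\sum_j p 0 j *: x j + \sum_j p 1 j *: x j).
  rewrite !pE (bigD1 k) //= sk scale0r add0r scale1r addrCA scalerDr.
  rewrite [in RHS]scalerDr -scalerDl (_ : 2^-1 + 2^-1 = 1 :> R); last by lra.
  by rewrite scale1r.
apply: strictly_convex_midpoint => //; [apply: p0|apply: p1|]; rewrite ?lexx ?ler01 //.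
rewrite !pE scale0r scale1r => /addIr xk0.
by have := hunit k; rewrite -xk0 normr0 => /esym/eqP; rewrite oner_eq0.
Qed.

Lemma collapsing_relation_max (c : 'I_m -> R) (i : 'I_m) :
  \sum_j c j *: x j = 0 -> 0 <= c i -> (forall j, c j <= c i) ->
  forall j, c j = c i.
Proof.
move=> c0 ci0 cmax j0; apply/eqP; rewrite eq_le cmax /= leNgt.
apply/negP => cj0.
pose t j := c i - c j.
have [k _ kmax] := @arg_maxP _ _ _ i xpredT t isT.
have tk0 : 0 < t k by apply: lt_le_trans (kmax j0 isT); rewrite subr_gt0.
have t_ge0 j : 0 <= t j by rewrite subr_ge0.
pose e := (2 * t k)^-1.
have e0 : 0 < e by rewrite invr_gt0 mulr_gt0.
have ek : e * t k = 2^-1 by rewrite /e invfM -mulrA mulVf ?mulr1 // gt_eqF.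
(* These coefficients stay in the unit interval because [t i = 0] and [e * t j <= e * t k = 1/2]. *)
pose s j := (j == i)%:R + e * t j.
have ti : t i = 0 by rewrite /t subrr.
have ki : k != i by apply: contraTneq tk0 => ->; rewrite ti ltxx.
have hs j : 0 <= s j <= 1.
  rewrite /s; have [->|_] := eqVneq j i.
    by rewrite ti mulr0 addr0 ler01 lexx.
  rewrite add0r mulr_ge0 ?(ltW e0) //=.
  have := ler_wpM2l (ltW e0) (kmax j isT); rewrite ek => h.
  by apply: le_trans h _; lra.
have := @collapsing_box_lt1 s k hs; rewrite {1}/s (negPf ki) add0r => /(_ ek).
pose S := \sum_j x j.
have -> : \sum_j s j *: x j = x i + (e * c i) *: S.
  under eq_bigr do rewrite scalerDl.
  rewrite big_split /= (bigD1 i) //= eqxx scale1r big1 ?addr0; last first.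
    by move=> j /negPf ->; rewrite scale0r.
  congr (_ + _); under eq_bigr do rewrite -scalerA scalerBl.
  by rewrite -scaler_sumr sumrB c0 subr0 -scaler_sumr scalerA.
apply/negP; rewrite -leNgt.
have : `|S - x i| <= 1.
  rewrite /S (bigD1 i) //= addrAC subrr add0r.
  have := hcol (~: [set i])%SET; rewrite (eq_bigl (fun j => j != i)) // => j.
  by rewrite !inE.
set a := e * c i; have a0 : 0 <= a by rewrite mulr_ge0 // ltW.
move=> /(ler_wpM2l a0); rewrite mulr1 => hS.
(* This rests on [(1 + a) *: x i = (x i + a *: S) - a *: (S - x i)]. *)
have : `|(1 + a) *: x i| <= `|x i + a *: S| + `|a *: (S - x i)|.
  apply: le_trans (ler_normB _ _).
  by rewrite scalerBr opprB addrA addrAC addrK scalerDl scale1r addrC.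
by rewrite normrZ (normrZ a) hunit (ger0_norm a0) ger0_norm ?addr_ge0 //; lra.
Qed.

Lemma collapsing_relation_constant (c : 'I_m -> R) :
  \sum_j c j *: x j = 0 -> forall i j, c i = c j.
Proof.
move=> c0 i j.
have [k _ kmax] := @arg_maxP _ _ _ i xpredT c isT.
have [ck|/ltW ck] := leP 0 (c k).
  by rewrite !(@collapsing_relation_max c k c0 ck (fun l => kmax l isT)).
(* All coefficients are now nonpositive, so the negated relation has a nonnegative maximum, attained
   where [c] is least. *)
have [l _ lmin] := @arg_minP _ _ _ i xpredT c isT.
suff cl n : c n = c l by rewrite !cl.
apply: oppr_inj; apply: (@collapsing_relation_max (fun j => - c j) l) => [||o].
- by under eq_bigr do rewrite scaleNr; rewrite sumrN c0 oppr0.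
- by rewrite oppr_ge0 (le_trans (lmin k isT)).
- by rewrite lerN2 lmin.
Qed.

End Collapsing.

Lemma relation_free_leq_dim (K : fieldType) (V : vectType K) (n : nat)
    (v : 'I_n -> V) :
  (forall c : 'I_n -> K, \sum_j c j *: v j = 0 -> forall j, c j = 0) ->
  (n <= \dim {:V})%N.
Proof.
move=> hv; have vfree : free [tuple v j | j < n].
  apply/freeP => c c0; apply: hv; rewrite -[RHS]c0.
  by apply: eq_bigr => j _; rewrite -tnth_nth tnth_mktuple.
have := dimvS (subvf <<[tuple v j | j < n]>>%VS).
by rewrite (eqP vfree) size_tuple.
Qed.

Theorem theorem4 (R : realType) (X : minkowskiSpaceType R) (d : nat)
    (hdim : \dim {:X} = d) (hconv : strictly_convex X)
    (m : nat) (x : 'I_m -> X)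
    (hunit : forall i : 'I_m, `|x i| = 1) (hcol : collapsing x) :
  (m <= d.+1)%N /\ (~ balancing x -> (m <= d)%N).
Proof.
rewrite -hdim; split=> [|nbal].
- case: m x hunit hcol => // n x hunit hcol; rewrite ltnS.
  apply: (@relation_free_leq_dim _ _ _ (fun j => x (lift ord0 j))) => c c0 j.
  (* The relation is extended by coefficient 0 at [ord0]; constancy then makes every [c j] equal to
     that 0. *)
  pose c' i := if unlift ord0 i is Some k then c k else 0.
  have c'0 : \sum_i c' i *: x i = 0.
    rewrite big_ord_recl /c' unlift_none scale0r add0r -[RHS]c0.
    by apply: eq_bigr => k _; rewrite liftK.
  have := @collapsing_relation_constant _ _ _ x hcol hconv hunit c' c'0
    (lift ord0 j) ord0.
  by rewrite /c' liftK unlift_none.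
- apply: (@relation_free_leq_dim _ _ _ x) => c c0 j.
  have cE := @collapsing_relation_constant _ _ _ x hcol hconv hunit c c0.
  (* With constant coefficients the relation is [c j] times the full sum, which is nonzero by
     [nbal]. *)
  move: c0; under eq_bigr do rewrite (cE _ j).
  by rewrite -scaler_sumr => /eqP; rewrite scaler_eq0 => /orP[/eqP//|/eqP].
Qed.
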